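(* Let $(a_n)_{n\in\mathbb{N}}$ be uniformly distributed in $[0,1]$, let $p\in(0,1)$, and let $(\xi_n)_{n\in\mathbb{N}}$ be i.i.d. random variables with values in $\{0,1\}$ and $\mathbb{P}(\xi_1=1)=p$. Let $m_1<m_2<\cdots$ enumerate $\{m:\xi_m=1\}$. Then, almost surely, the subsequence $(a_{m_i})_{i\in\mathbb{N}}$ is uniformly distributed in $[0,1]$.
   Context: A sequence $(a_n)$ in $[0,1]$ is uniformly distributed if $\lim_{n\to\infty}\frac1n\sum_{m=1}^n\mathbf 1_{[\alpha,\beta]}(a_m)=\beta-\alpha$ for all $0\leqslant\alpha<\beta\leqslant1$. *)

(* Defs.v *)
From HB Require Import structures.
From mathcomp Require Import all_boot all_order all_algebra.
From mathcomp Require Import all_classical all_reals all_analysis.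
Set Implicit Arguments. Unset Strict Implicit. Unset Printing Implicit Defensive.
Import Order.TTheory GRing.Theory Num.Theory.
Import numFieldNormedType.Exports.
Local Open Scope classical_set_scope.
Local Open Scope ring_scope.

Definition unif_distributed {R : realType} (a : nat -> R) : Prop :=
  forall alpha beta : R, 0 <= alpha -> alpha < beta -> beta <= 1 ->
    (fun n : nat => n%:R^-1 * \sum_(m < n) ((alpha <= a m) && (a m <= beta))%:R)
      @ \oo --> beta - alpha.

Definition mutually_independent_rv {d} {T : measurableType d} {R : realType}
  (P : probability T R) (X : nat -> T -> R) : Prop :=
  forall (I : seq nat) (B : nat -> set R), uniq I ->
    (forall i, i \in I -> measurable (B i)) ->
    P (\bigcap_(i in [set` I]) (X i @^-1` B i)) =
      (\prod_(i <- I) P (X i @^-1` B i))%E.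

(* Main.v *)
Require Import Defs.
From HB Require Import structures.
From mathcomp Require Import all_boot all_order all_algebra.
From mathcomp Require Import all_classical all_reals all_analysis.
From mathcomp Require Import measurable_realfun.
From mathcomp Require Import lra ring zify.
Import Order.TTheory GRing.Theory Num.Theory.
Import numFieldNormedType.Exports.
Local Open Scope classical_set_scope.
Local Open Scope ring_scope.

(* For a fixed interval I, the variables (xi_m - p) 1_I(a_m) are bounded and
   uncorrelated, so their means tend to 0 almost surely, and almost surely this
   holds for all intervals with rational endpoints at once. Since (a_n) is
   uniformly distributed, it then holds for every interval [alpha, beta], so the
   mean of xi_m 1_I(a_m) tends to p (beta - alpha) and that of xi_m tends to p.
   Taking both means at n = m_i and dividing gives the frequency of I along the
   subsequence. *)

(** * Strong law for bounded uncorrelated variables *)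

Definition mean {R : realType} (u : nat -> R) (n : nat) : R :=
  n%:R^-1 * \sum_(m < n) u m.

(** By exchanging sum and integral, the sum of the series is integrable, hence finite almost
    everywhere, and the terms of a convergent series tend to 0. *)
Lemma ae_cvg0_of_nneseries_integral (R : realType) (d : measure_display)
  (T : measurableType d) (mu : {measure set T -> \bar R}) (f : nat -> T -> R) :
  (forall n, measurable_fun setT (f n)) -> (forall n t, 0 <= f n t) ->
  (\sum_(n <oo) \int[mu]_t (f n t)%:E < +oo)%E ->
  {ae mu, forall t, f ^~ t @ \oo --> 0}.
Proof.
move=> mf f0 foo.
have mEf n : measurable_fun setT (EFin \o f n) by exact/measurable_EFinP.
have F0 t : (0 <= \sum_(n <oo) (f n t)%:E)%E.
  by apply: nneseries_ge0 => n _ _; rewrite lee_fin.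
have intF : mu.-integrable setT (fun t => \sum_(n <oo) (f n t)%:E)%E.
  apply/integrableP; split.
    by apply: (ge0_emeasurable_sum (P := xpredT)) => [k x _ _|k _];
      [rewrite lee_fin|exact: mEf].
  under eq_integral do rewrite gee0_abs//.
  by rewrite integral_nneseries// => n t _; rewrite lee_fin.
apply: filterS (integrable_ae measurableT intF) => t /(_ I) Ft.
apply: cvg_series_cvg_0; apply: nondecreasing_is_cvgn.
  by apply/nondecreasing_seqP => n; rewrite /series/= big_nat_recr//= lerDl.
exists (fine (\sum_(n <oo) (f n t)%:E)%E) => _ [n _ <-].
rewrite -lee_fin fineK// /series/= -sumEFin.
by apply: nneseries_lim_ge => k _ _; rewrite lee_fin.
Qed.

Lemma bounded_fun_integrable (R : realType) (d : measure_display)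
  (T : measurableType d) (P : probability T R) (f : T -> R) (M : R) :
  measurable_fun setT f -> (forall t, `|f t| <= M) ->
  P.-integrable setT (EFin \o f).
Proof.
move=> mf fM; apply: measurable_bounded_integrable => //.
  by rewrite -ge0_fin_numE// fin_num_measure.
exists M; split; first exact: num_real.
by move=> x Mx t _; apply: (le_trans (fM t)); exact: ltW.
Qed.

(** When the square is expanded the cross terms integrate to zero, leaving [n] diagonal terms, each
    at most [M ^+ 2]. *)
Lemma Rintegral_sqr_sum_uncorrelated (R : realType) (d : measure_display)
  (T : measurableType d) (P : probability T R) (X : nat -> T -> R) (M : R) :
  (forall n, measurable_fun setT (X n)) -> (forall n t, `|X n t| <= M) ->
  (forall i j, (i < j)%N -> \int[P]_t (X i t * X j t) = 0) ->
  forall n, \int[P]_t (\sum_(m < n) X m t) ^+ 2 <= n%:R * M ^+ 2.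
Proof.
move=> mX XM XX n.
have mS k : measurable_fun setT (fun t => \sum_(m < k) X m t).
  exact: measurable_sum.
have SM k t : `|\sum_(m < k) X m t| <= k%:R * M.
  apply: le_trans (ler_norm_sum _ _ _) _.
  apply: le_trans (ler_sum _ (fun (i : 'I_k) _ => XM i t)) _.
  by rewrite sumr_const card_ord mulr_natl.
(* A space of total mass 1 is nonempty, and any of its points gives [0 <= M]. *)
have M0 : 0 <= M.
  have [t _] : exists t : T, True.
    apply: contrapT => T0; have := @probability_setT _ _ _ P.
    rewrite (_ : setT = set0) ?measure0; last first.
      by apply/seteqP; split=> t // _; apply: T0; exists t.
    by move=> /eqP; rewrite eq_sym onee_eq0.
  exact: le_trans (normr_ge0 _) (XM 0%N t).
have iprod (f g : T -> R) (B C : R) :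
    measurable_fun setT f -> measurable_fun setT g ->
    (forall t, `|f t| <= B) -> (forall t, `|g t| <= C) ->
    P.-integrable setT (EFin \o (fun t => f t * g t)).
  move=> mf mg fB gC; apply: (@bounded_fun_integrable _ _ _ _ _ (B * C)).
    exact: measurable_funM.
  by move=> t; rewrite normrM ler_pM.
(* All indices in the sum are below [k <= j], so each product with [X j] integrates to zero. *)
have cross k j : (k <= j)%N -> \int[P]_t ((\sum_(m < k) X m t) * X j t) = 0.
  elim: k => [|k IH] kj.
    under eq_Rintegral do rewrite big_ord0 mul0r.
    by rewrite Rintegral_cst// mul0r.
  under eq_Rintegral do rewrite big_ord_recr/= mulrDl.
  rewrite RintegralD//; last 2 first.
  - exact: iprod (SM k) (XM j).
  - exact: iprod (XM k) (XM j).
  by rewrite IH ?(ltnW kj)// XX// addr0.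
elim: n => [|n IH].
  under eq_Rintegral do rewrite big_ord0 expr0n/=.
  by rewrite Rintegral_cst// mul0r mul0r.
under eq_Rintegral do rewrite big_ord_recr/= sqrrD -mulr_natl -addrA !expr2.
have iSS := iprod _ _ _ _ (mS n) (mS n) (SM n) (SM n).
have iSX := iprod _ _ _ _ (mS n) (mX n) (SM n) (XM n).
have iXX := iprod _ _ _ _ (mX n) (mX n) (XM n) (XM n).
have i2SX : P.-integrable setT
    (EFin \o (fun t => 2 * ((\sum_(m < n) X m t) * X n t))).
  by have := integrableZl measurableT 2 iSX; apply: eq_integrable.
rewrite RintegralD//; last first.
  by have := integrableD measurableT i2SX iXX; apply: eq_integrable.
rewrite RintegralD// RintegralZl// cross// mulr0 add0r.
rewrite mulrSr mulrDl mul1r; apply: lerD.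
  by under eq_Rintegral do rewrite -expr2.
apply: (@le_trans _ _ (\int[P]_t (M ^+ 2))).
  apply: le_Rintegral => //.
    apply: (@bounded_fun_integrable _ _ _ _ _ `|M ^+ 2|) => //.
  by move=> t _; rewrite -expr2 -[leLHS]ger0_norm ?sqr_ge0// normrX ler_sqr ?nnegrE.
by rewrite Rintegral_cst//= [X in fine X](@probability_setT _ _ _ P) mulr1.
Qed.

(* Between consecutive squares [k ^ 2] and [k.+1 ^ 2] the partial sums vary by
   at most [2 k M]. *)
Lemma cesaro_cvg0_of_squares (R : realType) (x : nat -> R) (M : R) :
  (forall n, `|x n| <= M) ->
  (fun k => mean x (k.+1 ^ 2)) @ \oo --> 0 -> mean x @ \oo --> 0.
Proof.
move=> xM /cvgr0Pnorm_lt sq; apply/cvgr0Pnorm_lt => e e0.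
have M0 : 0 <= M := le_trans (normr_ge0 _) (xM 0%N).
have e20 : 0 < e / 2 by rewrite divr_gt0.
have [K _ HK] := sq _ e20.
(* For [k >= L] one has [4 * M < k.+1 * e], so a remainder of size [2 * k.+1 * M] stays below
   [k.+1 ^ 2 * e / 2], hence below [n * e / 2]. *)
pose L := Num.truncn (4 * M / e).
pose N := ((K + L).+1 ^ 2)%N.
exists N => // n /= Nn.
(* [k.+1] is the integer square root of [n]. *)
have [k [kK kL kn nk]] : exists k, [/\ (K <= k)%N, (L <= k)%N,
    (k.+1 ^ 2 <= n)%N & (n < k.+2 ^ 2)%N].
  have : exists k, (k.+1 ^ 2 <= n)%N by exists (K + L)%N.
  move=> exk; have ub k : (k.+1 ^ 2 <= n)%N -> (k <= n)%N.
    move=> kn; apply: leq_trans kn; nia.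
  case: (ex_maxnP exk ub) => k kn kmax.
  have KLk := kmax _ Nn.
  exists k; split=> //; [lia|lia|].
  by rewrite ltnNge; apply/negP => /kmax; rewrite ltnn.
have n0 : 0 < n%:R :> R by rewrite ltr0n; nia.
have q0 : 0 < (k.+1 ^ 2)%:R :> R by rewrite ltr0n; nia.
have qn : (k.+1 ^ 2)%:R <= n%:R :> R by rewrite ler_nat.
have := HK k kK; rewrite /= /mean !normrM !normfV (gtr0_norm n0) (gtr0_norm q0).
rewrite ltr_pdivrMl// => Hk; rewrite ltr_pdivrMl//.
have -> : \sum_(m < n) x m =
    \sum_(m < k.+1 ^ 2) x m + \sum_(k.+1 ^ 2 <= m < n) x m.
  by rewrite -!(big_mkord xpredT) -big_cat_nat.
apply: le_lt_trans (ler_normD _ _) _.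
have tail : `|\sum_(k.+1 ^ 2 <= m < n) x m| <= (2 * k.+1)%:R * M.
  apply: le_trans (ler_norm_sum _ _ _) _.
  apply: (@le_trans _ _ (\sum_(k.+1 ^ 2 <= m < n) M)); first exact: ler_sum.
  (* Since [n < k.+2 ^ 2], at most [2 * k.+1] terms lie past the square. *)
  rewrite sumr_const_nat -[leLHS]mulr_natl ler_wpM2r// ler_nat; nia.
have kM : 4 * M < k.+1%:R * e.
  rewrite -ltr_pdivrMr//; apply: lt_le_trans (truncnS_gt _) _.
  by rewrite ler_nat.
have kk : (k.+1 ^ 2)%:R = k.+1%:R ^+ 2 :> R by rewrite natrX.
have k10 : 0 < k.+1%:R :> R by rewrite ltr0n.
rewrite natrM in tail.
nra.
Qed.

Lemma sum_inv_sqr_le2 (R : realType) n :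
  \sum_(k < n) (k.+1%:R ^+ 2)^-1 <= 2 :> R.
Proof.
case: n => [|n]; first by rewrite big_ord0.
(* The subtracted [n.+1^-1] makes the bound inductive, as in a telescoping sum. *)
suff : \sum_(k < n.+1) (k.+1%:R ^+ 2)^-1 <= 2 - n.+1%:R^-1 :> R.
  by move=> /le_trans; apply; rewrite lerBlDr lerDl invr_ge0.
elim: n => [|n IH]; first by rewrite big_ord1 expr1n invr1; lra.
rewrite big_ord_recr/=; apply: le_trans (lerD IH (lexx _)) _.
have x0 : 0 < n.+1%:R :> R by rewrite ltr0n.
rewrite -(natr1 n.+1) -subr_ge0.
(* The exact slack of the induction step. *)
rewrite (_ : _ - _ = (n.+1%:R * (n.+1%:R + 1) ^+ 2)^-1).
  by rewrite invr_ge0; nra.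
field.
by rewrite !gt_eqF// ltr_wpDr.
Qed.

(* Rajchman: second moments give convergence along the squares, for which the
   variance bounds [M ^ 2 / k.+1 ^ 2] are summable. *)
Lemma strong_law_uncorrelated (R : realType) (d : measure_display)
  (T : measurableType d) (P : probability T R) (X : nat -> T -> R) (M : R) :
  (forall n, measurable_fun setT (X n)) -> (forall n t, `|X n t| <= M) ->
  (forall i j, (i < j)%N -> \int[P]_t (X i t * X j t) = 0) ->
  {ae P, forall t, mean (X ^~ t) @ \oo --> 0}.
Proof.
move=> mX XM XX.
pose S n t := \sum_(m < n) X m t.
pose f k t := ((k.+1 ^ 2)%:R^-1 * S (k.+1 ^ 2)%N t) ^+ 2.
have mS n : measurable_fun setT (S n) by exact: measurable_sum.
have SM n t : `|S n t| <= n%:R * M.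
  apply: le_trans (ler_norm_sum _ _ _) _.
  apply: le_trans (ler_sum _ (fun (i : 'I_n) _ => XM i t)) _.
  by rewrite sumr_const card_ord mulr_natl.
have mf k : measurable_fun setT (f k).
  by apply: measurable_funX; exact: measurable_funM.
have f0 k t : 0 <= f k t by exact: sqr_ge0.
have iS n : P.-integrable setT (EFin \o (fun t => S n t ^+ 2)).
  apply: (@bounded_fun_integrable _ _ _ _ _ ((n%:R * M) ^+ 2)).
    exact: measurable_funX.
  by move=> t; rewrite normrX ler_sqr ?nnegrE// (le_trans _ (SM n t)).
have q0 k : 0 < (k.+1 ^ 2)%:R :> R by rewrite ltr0n expn_gt0.
have f_int k : P.-integrable setT (EFin \o f k).
  have := integrableZl measurableT ((k.+1 ^ 2)%:R^-1 ^+ 2) (iS (k.+1 ^ 2)%N).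
  by apply: eq_integrable => // t _; rewrite /f /= exprMn EFinM.
(* With [N = k.+1 ^ 2] terms the second moment is at most [N * M ^+ 2], and the squared
   normalisation divides it by [N ^ 2]. *)
have intf_le k : (\int[P]_t (f k t)%:E <= (M ^+ 2 * (k.+1%:R ^+ 2)^-1)%:E)%E.
  rewrite -(fineK (integrable_fin_num measurableT (f_int k))) lee_fin.
  rewrite -/(Rintegral P setT (f k)) /f.
  under eq_Rintegral do rewrite exprMn.
  rewrite RintegralZl// exprVn ler_pdivrMl ?exprn_gt0//.
  apply: le_trans (Rintegral_sqr_sum_uncorrelated _ _ _ _ _ _ mX XM XX _) _.
  rewrite -natrX [leRHS](_ : _ = (k.+1 ^ 2)%:R * M ^+ 2)//.
  by field; rewrite gt_eqF.
have : (\sum_(k <oo) \int[P]_t (f k t)%:E < +oo)%E.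
  apply: (@le_lt_trans _ _ (M ^+ 2 * 2)%:E); last exact: ltry.
  apply: lime_le.
    by apply: is_cvg_nneseries => n _ _; apply: integral_ge0 => t _; rewrite lee_fin.
  apply: nearW => n.
  apply: le_trans (lee_sum _ (fun k _ => intf_le k)) _.
  rewrite sumEFin lee_fin big_mkord -mulr_sumr ler_wpM2l ?sqr_ge0//.
  exact: sum_inv_sqr_le2.
move=> /(ae_cvg0_of_nneseries_integral _ _ _ P f mf f0).
apply: filterS => t ft; refine (cesaro_cvg0_of_squares _ _ M (XM^~ t) _).
apply/cvgr0Pnorm_lt => e e0.
(* [f k t] is the square of the mean, so the threshold [e ^+ 2] for it is the threshold [e] for the
   mean. *)
move/cvgr0Pnorm_lt : ft => /(_ _ (exprn_gt0 2 e0)); apply: filterS => k.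
by rewrite /f normrX ltr_sqr ?nnegrE// ltW.
Qed.

(** * Increasing enumeration of an infinite set of indices *)

(** Start from the least element of [B] and repeatedly take the least element beyond the current
    one. *)
Lemma increasing_enumeration (B : pred nat) :
  (forall n, exists2 k, (n <= k)%N & B k) ->
  exists m : nat -> nat, (forall i j, (i < j)%N -> (m i < m j)%N) /\
    range m = [set k | B k].
Proof.
move=> Binf.
have next_ex n : exists k, [/\ (n <= k)%N, B k &
    forall k', (n <= k')%N -> B k' -> (k <= k')%N].
  have ex : exists k, (n <= k)%N && B k.
    by have [k nk Bk] := Binf n; exists k; rewrite nk.
  case: (ex_minnP ex) => k /andP[nk Bk] kmin.
  by exists k; split=> // k' nk' Bk'; apply: kmin; rewrite nk'.
pose next n := sval (cid (next_ex n)).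
have nextP n : [/\ (n <= next n)%N, B (next n) &
    forall k', (n <= k')%N -> B k' -> (next n <= k')%N].
  exact: svalP (cid (next_ex n)).
pose m := fix m i := if i is i'.+1 then next (m i').+1 else next 0%N.
have mS i : (m i < m i.+1)%N by have [] := nextP (m i).+1.
have m_incr : {homo m : i j / (i < j)%N}.
  exact: (homo_ltn ltn_trans).
have m_ge i : (i <= m i)%N.
  by elim: i => // i IH; apply: leq_ltn_trans IH (mS i).
exists m; split => //; apply/seteqP; split=> [_ [[|i] _ <-]|k /= Bk].
- by have [] := nextP 0%N.
- by have [] := nextP (m i).+1.
(* For the least such [i], the previous value is below [k], so minimality of [next] forces
   [m i <= k]. *)
have ex : exists i, (k <= m i)%N by exists k.
case: (ex_minnP ex) => i ki imin; exists i => //.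
apply/eqP; rewrite eqn_leq ki andbT.
case: i ki imin => [_ _|i ki imin].
  by have [_ _] := nextP 0%N; apply.
have [_ _] := nextP (m i).+1; apply=> //.
by rewrite ltnNge; apply/negP => /imin; rewrite ltnn.
Qed.

(** The elements of [B] below [m i] are exactly [m 0], ..., [m (i - 1)]. *)
Lemma sum_increasing_enumeration (V : nmodType) (B : pred nat) (m : nat -> nat)
  (f : nat -> V) :
  (forall i j, (i < j)%N -> (m i < m j)%N) -> range m = [set k | B k] ->
  forall i, \sum_(k < m i | B k) f k = \sum_(j < i) f (m j).
Proof.
move=> m_incr mB i.
have m_mono i1 i2 : (m i1 < m i2)%N -> (i1 < i2)%N.
  by move=> mm; rewrite ltnNge leq_eqVlt; apply/negP => /predU1P[e|/m_incr];
     [move: mm; rewrite e ltnn|rewrite ltnNge ltnW].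
have BE k : B k -> exists j, m j = k.
  by move=> Bk; have : [set k | B k] k by []; rewrite -mB => -[j _ <-]; exists j.
elim: i => [|i IH].
  rewrite big_ord0 big1// => k /BE[j jk].
  by have := ltn_ord k; rewrite -jk => /m_mono.
rewrite big_ord_recr/= -IH -!(big_mkord B).
rewrite (@big_cat_nat _ _ _ (m i))//=; last by rewrite ltnW// m_incr.
congr (_ + _); rewrite big_ltn_cond ?m_incr//.
have -> : B (m i) by have : range m (m i) by []; rewrite mB.
(* An element of [B] strictly between [m i] and [m i.+1] would have an index strictly between [i]
   and [i.+1]. *)
rewrite big_nat_cond big1 ?addr0// => k /andP[/andP[ik ki] /BE[j jk]].
by move: ik ki; rewrite -jk => /m_mono ij /m_mono; rewrite ltnS leqNgt ij.
Qed.

(** * Interval frequencies: from rational to real endpoints *)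

Lemma mean_le (R : realType) (u v : nat -> R) n :
  (forall k, u k <= v k) -> mean u n <= mean v n.
Proof. by move=> uv; rewrite /mean ler_wpM2l ?invr_ge0// ler_sum. Qed.

Lemma meanD (R : realType) (u v : nat -> R) n :
  mean (fun k => u k + v k) n = mean u n + mean v n.
Proof. by rewrite /mean big_split/= mulrDr. Qed.

Lemma meanZ (R : realType) (c : R) (u : nat -> R) n :
  mean (fun k => c * u k) n = c * mean u n.
Proof. by rewrite /mean -mulr_sumr mulrCA. Qed.

Lemma norm_mean_le (R : realType) (u : nat -> R) n :
  `|mean u n| <= mean (fun k => `|u k|) n.
Proof.
by rewrite /mean normrM ger0_norm ?invr_ge0// ler_wpM2l ?invr_ge0// ler_norm_sum.
Qed.

(** For rational [r] within [e] below [alpha], the closed interval from [r] to [alpha] has limiting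
    frequency [alpha - r < e]. At [alpha = 0] there is no room on the left, but [r = 0] gives an
    empty set. *)
Lemma ud_left_density (R : realType) (a : nat -> R) (alpha e : R) :
  (forall n, 0 <= a n <= 1) -> unif_distributed a ->
  0 <= alpha <= 1 -> 0 < e ->
  exists2 r : rat, ratr r <= alpha &
    \forall n \near \oo,
      mean (fun m => ((ratr r <= a m) && (a m < alpha))%:R) n < e.
Proof.
move=> a01 uda /andP[a0 a1] e0.
have [->|an0] := eqVneq alpha 0.
  exists 0; rewrite ?rmorph0//; apply: nearW => n.
  rewrite /mean big1 ?mulr0// => i _; have /andP[ai _] := a01 i.
  by rewrite [X in _ && X]ltNge ai andbF.
have agt0 : 0 < alpha by rewrite lt_neqAle eq_sym an0.
have [r] : exists r : rat, ratr r \in `]Num.max 0 (alpha - e), alpha[.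
  by apply: rat_in_itvoo; rewrite gt_max agt0 gtrBl e0.
rewrite in_itv/= gt_max => /andP[/andP[r0 re] ra].
exists r; first exact: ltW.
have : mean (fun m => ((ratr r <= a m) && (a m <= alpha))%:R) @ \oo -->
  alpha - ratr r := uda _ _ (ltW r0) ra a1.
move=> /cvgr_lt /(_ e); rewrite ltrBlDl -ltrBlDr => /(_ re); apply: filterS => n.
apply: le_lt_trans; apply: mean_le => k.
by rewrite ler_nat; case: (_ <= a k) => //=; case: ltP => // /ltW ->.
Qed.

(** Mirror image of the left case; the boundary value is now [beta = 1], where [s = 1] gives an
    empty set. *)
Lemma ud_right_density (R : realType) (a : nat -> R) (beta e : R) :
  (forall n, 0 <= a n <= 1) -> unif_distributed a ->
  0 <= beta <= 1 -> 0 < e ->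
  exists2 s : rat, beta <= ratr s &
    \forall n \near \oo,
      mean (fun m => ((beta < a m) && (a m <= ratr s))%:R) n < e.
Proof.
move=> a01 uda /andP[b0 b1] e0.
have [->|bn1] := eqVneq beta 1.
  exists 1; rewrite ?rmorph1//; apply: nearW => n.
  rewrite /mean big1 ?mulr0// => i _; have /andP[_ ai] := a01 i.
  by rewrite ltNge ai.
have blt1 : beta < 1 by rewrite lt_neqAle bn1.
have [s] : exists s : rat, ratr s \in `]beta, Num.min 1 (beta + e)[.
  by apply: rat_in_itvoo; rewrite lt_min blt1 ltrDl e0.
rewrite in_itv/= lt_min => /andP[bs /andP[s1 se]].
exists s; first exact: ltW.
have : mean (fun m => ((beta <= a m) && (a m <= ratr s))%:R) @ \oo -->
  ratr s - beta := uda _ _ b0 bs (ltW s1).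
move=> /cvgr_lt /(_ e); rewrite ltrBlDl => /(_ se); apply: filterS => n.
apply: le_lt_trans; apply: mean_le => k.
by rewrite ler_nat; case: ltP => // /ltW ->.
Qed.

(* An interval with real endpoints differs from a rational one by a set of
   small density, so countably many intervals control all of them. *)
Lemma mean_interval_cvg0 (R : realType) (a x : nat -> R) :
  (forall n, 0 <= a n <= 1) -> unif_distributed a ->
  (forall n, `|x n| <= 1) ->
  (forall r s : rat,
    mean (fun m => x m * ((ratr r <= a m) && (a m <= ratr s))%:R) @ \oo --> 0) ->
  forall alpha beta : R, 0 <= alpha -> alpha < beta -> beta <= 1 ->
    mean (fun m => x m * ((alpha <= a m) && (a m <= beta))%:R) @ \oo --> 0.
Proof.
move=> a01 uda x1 xrs alpha beta a0 ab b1; apply/cvgr0Pnorm_lt => e e0.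
have e30 : 0 < e / 3 by rewrite divr_gt0.
have a1 : 0 <= alpha <= 1 by rewrite a0 (le_trans (ltW ab)).
have b01 : 0 <= beta <= 1 by rewrite b1 (le_trans a0) ?ltW.
have [r ra Hr] := ud_left_density _ _ _ _ a01 uda a1 e30.
have [s bs Hs] := ud_right_density _ _ _ _ a01 uda b01 e30.
have /cvgr0Pnorm_lt /(_ _ e30) Hrs := xrs r s.
near=> n.
pose u m : R := ((ratr r <= a m) && (a m < alpha))%:R.
pose v m : R := ((beta < a m) && (a m <= ratr s))%:R.
pose w m : R := ((ratr r <= a m) && (a m <= ratr s))%:R.
(* The indicator of the real interval is [w - u - v]: the rational interval minus its left and right
   overhangs. *)
have -> : mean (fun m => x m * ((alpha <= a m) && (a m <= beta))%:R) n =
    mean (fun m => x m * w m) n +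
    mean (fun m => - (x m * u m) + - (x m * v m)) n.
  rewrite -meanD; congr mean; apply/funext => m; rewrite -!mulrN -!mulrDr.
  congr (_ * _); rewrite /u /v /w.
  have [ma|am] := ltP (a m) alpha.
    have mb := lt_trans ma ab.
    rewrite (le_gtF (ltW mb)) (ltW (lt_le_trans mb bs)) !andbT.
    by rewrite oppr0 addr0 subrr.
  rewrite (le_trans ra am) /=.
  have [mb|bm] := leP (a m) beta.
    by rewrite (le_trans mb bs)/= oppr0 !addr0.
  by rewrite oppr0 add0r subrr.
apply: le_lt_trans (ler_normD _ _) _.
have tail : `|mean (fun m => - (x m * u m) + - (x m * v m)) n| <=
    mean u n + mean v n.
  apply: le_trans (norm_mean_le _ _ _) _; rewrite -meanD; apply: mean_le => m.
  apply: le_trans (ler_normD _ _) _; rewrite !normrN !normrM.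
  by apply: lerD; rewrite [X in _ * X]ger0_norm ?ler0n// ler_piMl ?ler0n.
apply: le_lt_trans (lerD (lexx _) tail) _.
have -> : e = e / 3 + (e / 3 + e / 3) by field.
rewrite ltrD ?ltrD//; near: n; [exact: Hrs|exact: Hr|exact: Hs].
Unshelve. all: by end_near. Qed.

(** * Vanishing covariance of independent indicators *)

(** The product expands to [\1_(A]&[B) - q * \1_A - p * \1_B + p * q], with integral
    [p * q - q * p - p * q + p * q = 0]. *)
Lemma Rintegral_centered_indic (R : realType) (d : measure_display)
  (T : measurableType d) (P : probability T R) (A B : set T) (p q : R) :
  measurable A -> measurable B -> P A = p%:E -> P B = q%:E ->
  P (A `&` B) = (p * q)%:E ->
  \int[P]_t ((\1_A t - p) * (\1_B t - q)) = 0.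
Proof.
move=> mA mB PA PB PAB.
have iI (C : set T) : measurable C -> P.-integrable setT (EFin \o (\1_C : T -> R)).
  move=> mC; apply: (@bounded_fun_integrable _ _ _ _ _ 1) => // t.
  by rewrite indicE; case: (_ \in _); rewrite ?normr1// normr0.
have RI (C : set T) (c : R) : measurable C -> P C = c%:E -> \int[P]_t \1_C t = c.
  by move=> mC PC; rewrite /Rintegral integral_indic// setIT [X in fine X]PC.
have iK c : P.-integrable setT (EFin \o (fun=> c : R)).
  exact: (@bounded_fun_integrable _ _ _ _ _ `|c|).
have mAB := measurableI _ _ mA mB.
have iqA : P.-integrable setT (EFin \o (fun t => q * \1_A t)).
  by have := integrableZl measurableT q (iI _ mA); apply: eq_integrable.
have ipB : P.-integrable setT (EFin \o (fun t => p * \1_B t)).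
  by have := integrableZl measurableT p (iI _ mB); apply: eq_integrable.
have i1 : P.-integrable setT (EFin \o (fun t => \1_(A `&` B) t - q * \1_A t)).
  by have := integrableB measurableT (iI _ mAB) iqA; apply: eq_integrable.
have i2 : P.-integrable setT
    (EFin \o (fun t => \1_(A `&` B) t - q * \1_A t - p * \1_B t)).
  by have := integrableB measurableT i1 ipB; apply: eq_integrable.
rewrite (_ : (fun t => _) =
    fun t => (\1_(A `&` B) t - q * \1_A t - p * \1_B t) + p * q); last first.
  by apply/funext => t; rewrite indicI/=; ring.
have iA := iI _ mA; have iB := iI _ mB; have iAB := iI _ mAB.
have ipq := iK (p * q).
rewrite RintegralD// RintegralB// RintegralB// RintegralZl// RintegralZl//.
rewrite (RI _ _ mAB PAB) (RI _ _ mA PA) (RI _ _ mB PB) Rintegral_cst//=.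
by rewrite [X in fine X](@probability_setT _ _ _ P)/=; ring.
Qed.

(** * Passage to the selected subsequence *)

Lemma increasing_cvg_infty (m : nat -> nat) :
  (forall i j, (i < j)%N -> (m i < m j)%N) -> m @ \oo --> \oo.
Proof.
move=> m_incr A [N _ NA]; exists N => // i /= Ni; apply: NA => /=.
apply: leq_trans Ni _; elim: i => // i IH.
by apply: leq_ltn_trans IH _; exact: m_incr.
Qed.

(** The deterministic half of the argument: [b] stands for one sample path of the selectors. *)
Lemma ud_subsequence (R : realType) (a b : nat -> R) (p : R) :
  (forall n, 0 <= a n <= 1) -> unif_distributed a -> 0 < p < 1 ->
  (forall n, b n = 0 \/ b n = 1) ->
  (forall r s : rat,
    mean (fun m => (b m - p) * ((ratr r <= a m) && (a m <= ratr s))%:R)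
      @ \oo --> 0) ->
  exists m : nat -> nat, (forall i j, (i < j)%N -> (m i < m j)%N) /\
    range m = [set k | b k = 1] /\ unif_distributed (a \o m).
Proof.
move=> a01 uda /andP[p0 p1] b01 brs.
have bp1 n : `|b n - p| <= 1.
  by case: (b01 n) => ->; rewrite ler_norml; apply/andP; split; lra.
have mean_int alpha beta : 0 <= alpha -> alpha < beta -> beta <= 1 ->
    mean (fun m => b m * ((alpha <= a m) && (a m <= beta))%:R) @ \oo -->
    p * (beta - alpha).
  move=> al0 ab be1.
  have h1 := mean_interval_cvg0 _ _ _ a01 uda bp1 brs _ _ al0 ab be1.
  have h2 : mean (fun m => ((alpha <= a m) && (a m <= beta))%:R) @ \oo -->
    beta - alpha := uda _ _ al0 ab be1.
  have := cvgD h1 (cvgM (cvg_cst p) h2); rewrite add0r => /(_ _ _ _) h.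
  refine (cvg_trans (near_eq_cvg _) h); apply: nearW => n /=.
  rewrite fctE/= -meanZ -meanD; congr mean; apply/funext => k; ring.
(* The interval from 0 to 1 contains every [a n], so its indicator drops out. *)
have meanb : mean b @ \oo --> p.
  have := mean_int 0 1 (lexx _) ltr01 (lexx _); rewrite subr0 mulr1.
  by under eq_fun do rewrite a01 mulr1.
pose B k := b k == 1.
have bB k : b k = (B k)%:R.
  by rewrite /B; case: (b01 k) => ->; rewrite ?eqxx// eq_sym oner_eq0.
(* If [b] vanished from [n] on, its mean would tend to 0 instead of [p > 0]. *)
have Binf n : exists2 k, (n <= k)%N & B k.
  apply: contrapT => nB.
  have bn k : (n <= k)%N -> b k = 0.
    by move=> nk; rewrite bB; case: (boolP (B k)) => // Bk; case: nB; exists k.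
  have invn : (fun k : nat => k%:R^-1 : R) @ \oo --> 0.
    apply/gtr0_cvgV0; last exact: cvgr_idn.
    by exists 1%N => // k /= k0; rewrite ltr0n.
  have := cvgM (cvg_cst (\sum_(m < n) b m)) invn; rewrite mulr0 => /(_ _ _) b0.
  have : mean b @ \oo --> 0.
    refine (cvg_trans (near_eq_cvg _) b0); exists n => // k /= nk.
    rewrite /mean mulrC -!(big_mkord xpredT b).
    rewrite [in RHS](big_cat_nat (n := n))//=.
    rewrite [X in _ + X]big_nat_cond [X in _ + X]big1 ?addr0// => l.
    by rewrite andbT => /andP[/bn].
  move=> /(cvg_unique (@Rhausdorff R) meanb) /eqP.
  by rewrite gt_eqF.
have [m [m_incr mB]] := increasing_enumeration B Binf.
exists m; split => //; split.
  by rewrite mB; apply/seteqP; split=> k /= /eqP.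
move=> alpha beta al0 ab be1.
have moo := increasing_cvg_infty _ m_incr.
have h1 := cvg_comp _ _ moo (mean_int _ _ al0 ab be1).
have h2 := cvg_comp _ _ moo meanb.
(* In the quotient of the two means at [m i] the factors [(m i)^-1] cancel, and the denominator
   becomes the count [i] of selected indices below [m i]. *)
have := cvgM h1 (cvgV (lt0r_neq0 p0) h2).
rewrite mulrAC divff ?gt_eqF// mul1r => /(_ _ _) h.
refine (cvg_trans (near_eq_cvg _) h).
(* [m 0] may be 0; from [i = 1] on both [i] and [m i] are nonzero. *)
exists 1%N => // i /= i0.
have sumB (f : nat -> R) : \sum_(k < m i) b k * f k = \sum_(j < i) f (m j).
  rewrite -(sum_increasing_enumeration _ _ _ f m_incr mB) [RHS]big_mkcond/=.
  by apply: eq_bigr => k _; rewrite bB; case: (B k); rewrite ?mul1r ?mul0r.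
have mi0 : (m i)%:R != 0 :> R.
  by rewrite pnatr_eq0 -lt0n (leq_ltn_trans _ (m_incr _ _ i0)).
rewrite /= /mean (sumB (fun k => ((alpha <= a k) && (a k <= beta))%:R)).
have -> : \sum_(k < m i) b k = i%:R.
  have := sumB (fun=> 1); under eq_bigr do rewrite mulr1.
  by move=> ->; rewrite sumr_const card_ord.
field.
by rewrite mi0 andbT pnatr_eq0 -lt0n.
Qed.

(** * Almost sure conclusion *)

Theorem theoremA1 (R : realType) (d : measure_display) (T : measurableType d)
  (P : probability T R) (a : nat -> R) (p : R) (xi : nat -> T -> R) :
  (forall n, 0 <= a n <= 1) ->
  unif_distributed a ->
  0 < p < 1 ->
  (forall n, measurable_fun setT (xi n)) ->
  (forall n t, xi n t = 0 \/ xi n t = 1) ->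
  mutually_independent_rv P xi ->
  (forall n, P (xi n @^-1` [set 1]) = p%:E) ->
  {ae P, forall t, exists m : nat -> nat,
      (forall i j, (i < j)%N -> (m i < m j)%N) /\
      range m = [set k | xi k t = 1] /\
      unif_distributed (a \o m)}.
Proof.
move=> a01 uda p01 mxi xi01 indep Pxi.
pose A n := xi n @^-1` [set 1].
have mA n : measurable (A n).
  by rewrite -[A n]setTI; exact: mxi.
have xiA n t : xi n t = \1_(A n) t.
  rewrite indicE; case: (xi01 n t) => e; rewrite e.
    by rewrite memNset// /A/= e => /eqP; rewrite eq_sym oner_eq0.
  by rewrite mem_set.
have xi1 n t : `|xi n t - p| <= 1.
  case/andP: p01 => p0 p1.
  by case: (xi01 n t) => ->; rewrite ler_norml; apply/andP; split; lra.
have PAA i j : (i < j)%N -> P (A i `&` A j) = (p * p)%:E.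
  move=> ij.
  have := indep [:: i; j] (fun=> [set 1]).
  rewrite !big_cons big_nil mule1 !Pxi EFinM => <-.
  - congr (P _); apply/seteqP; split=> [t [/= Ai Aj] k /=|t Ht].
      by rewrite !inE => /orP[] /eqP ->.
    by split; apply: Ht; rewrite /= !inE eqxx ?orbT.
  - by rewrite /= inE andbT ltn_eqF.
  - by move=> *; exact: measurable_set1.
have ae_rs (r s : rat) : {ae P, forall t,
    mean (fun m => (xi m t - p) * ((ratr r <= a m) && (a m <= ratr s))%:R)
      @ \oo --> 0}.
  (* The weights [c m] are deterministic, so they factor out of the covariances and preserve the
     bound 1. *)
  pose c m : R := ((ratr r <= a m) && (a m <= ratr s))%:R.
  apply: (strong_law_uncorrelated _ _ _ _ (fun m t => (xi m t - p) * c m) 1).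
  - by move=> n; apply: measurable_funM => //; exact: measurable_funB.
  - move=> n t; rewrite normrM [X in _ * X]ger0_norm ?ler0n//.
    by apply: mulr_ile1; rewrite ?ler0n ?normr_ge0// /c; case: (_ && _).
  - move=> i j ij.
    have i0 := Rintegral_centered_indic _ _ _ P _ _ _ _ (mA i) (mA j) (Pxi i)
      (Pxi j) (PAA _ _ ij).
    rewrite (_ : (fun t => _) =
      fun t => (c i * c j) * ((\1_(A i) t - p) * (\1_(A j) t - p))); last first.
      by apply/funext => t; rewrite !xiA; ring.
    rewrite RintegralZl// ?i0 ?mulr0//.
    apply: (@bounded_fun_integrable _ _ _ _ _ 1).
      by apply: measurable_funM; apply: measurable_funB => //;
        exact: measurable_indic.
    by move=> t; rewrite -!xiA normrM mulr_ile1.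
(* Pairs of rationals are coded by naturals, so the exceptional sets form a countable family of null
   sets; a code of no pair carries the trivial condition. *)
have {ae_rs} : {ae P, forall t n, if unpickle n is Some rs then
    mean (fun m => (xi m t - p) *
      ((ratr (rs : rat * rat).1 <= a m) && (a m <= ratr rs.2))%:R)
      @ \oo --> 0 else True}.
  apply: ae_foralln => n; case: (unpickle n) => [[r s]|]; first exact: ae_rs.
  exact: aeW.
apply: filterS => t ht; apply: (ud_subsequence _ _ (xi ^~ t) p) => // r s.
by have := ht (pickle (r, s)); rewrite pickleK.
Qed.
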